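(* Let $d\geq2$ and $0\leq N<d!$ be integers. Then $$\mathrm{des}(\aleph^{-1}(N))=N-\sum_{i=0}^{d-2}\left\lfloor\frac{N}{i!\,(i+2)}\right\rfloor.$$
   Context: $\mathfrak{S}_d$ is the set of permutations $\pi=\pi_1\cdots\pi_d$ of $\{1,\ldots,d\}$; $\mathrm{des}(\pi)$ is the number of $j\in\{1,\ldots,d-1\}$ with $\pi_j>\pi_{j+1}$. The inversion table of $\pi$ is $(c_1,\ldots,c_d)$ with $c_i=\#\{j>i:\pi_i>\pi_j\}$ (so $0\leq c_i\leq d-i$). The map $\aleph:\mathfrak{S}_d\to\{0,1,\ldots,d!-1\}$, $\aleph(\pi)=\sum_{i=1}^dc_i\,(d-i)!$, is a bijection, and $\aleph^{-1}$ denotes its inverse. *)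

(* Defs.v *)
From HB Require Import structures.
From mathcomp Require Import all_boot all_order all_fingroup all_algebra.
From mathcomp Require Import zify.

Set Implicit Arguments.
Unset Strict Implicit.
Unset Printing Implicit Defensive.

(* A permutation of {1, ..., d} is an element of 'S_d, so both positions and
   values are shifted down by one: pi_(i+1) corresponds to p i + 1. *)

Definition des (d : nat) (p : 'S_d) : nat :=
  #|[set i : 'I_d | [exists j : 'I_d, (j == i.+1 :> nat) && (p j < p i)]]|.

Definition inv_table (d : nat) (p : 'S_d) (i : 'I_d) : nat :=
  #|[set j : 'I_d | (i < j) && (p j < p i)]|.

(* With 0-based i the weight (d - i)! becomes (d - i.+1)!. *)
Definition aleph_nat (d : nat) (p : 'S_d) : nat :=
  \sum_(i < d) inv_table p i * (d - i.+1)`!.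

Lemma inv_table_le (d : nat) (p : 'S_d) (i : 'I_d) :
  inv_table p i <= d - i.+1.
Proof.
have -> : d - i.+1 = #|[set j : 'I_d | i < j]|.
  rewrite -sum1dep_card -(big_mkord (fun j => i < j) (fun=> 1)) /=.
  rewrite (big_cat_nat (n := i.+1)) //= big_nat_cond big_pred0; last first.
    by move=> j; lia.
  rewrite add0n big_nat_cond (eq_bigl (fun j => (i < j < d) && true)); last first.
    by move=> j; lia.
  by rewrite -big_nat_cond sum_nat_const_nat muln1.
by apply/subset_leq_card/subsetP => j; rewrite !inE => /andP[].
Qed.

Lemma fact_base_lt (f : nat -> nat) (n : nat) :
  (forall k, k < n -> f k <= k) -> \sum_(k < n) f k * k`! < n`!.
Proof.
elim: n => [|n IHn] fle; first by rewrite big_ord0.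
rewrite big_ord_recr /= factS mulSn.
have lt_n : \sum_(k < n) f k * k`! < n`!.
  by apply: IHn => k kn; apply: fle; apply: ltnW.
by rewrite -addSn; apply: leq_add => //; rewrite leq_mul2r fle ?orbT.
Qed.

Lemma fact_base_inj (f g : nat -> nat) (n : nat) :
  (forall k, k < n -> f k <= k) -> (forall k, k < n -> g k <= k) ->
  \sum_(k < n) f k * k`! = \sum_(k < n) g k * k`! ->
  forall k, k < n -> f k = g k.
Proof.
elim: n => [|n IHn] fle gle; first by [].
have ltf : \sum_(k < n) f k * k`! < n`!.
  by apply: fact_base_lt => k kn; apply: fle; apply: ltnW.
have ltg : \sum_(k < n) g k * k`! < n`!.
  by apply: fact_base_lt => k kn; apply: gle; apply: ltnW.
rewrite !big_ord_recr /= => eq_fg.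
have eq_n : f n = g n.
  have := congr1 (fun x => x %/ n`!) eq_fg.
  by rewrite /= ![_ + _ * _]addnC !divnMDl ?fact_gt0 // !divn_small // !addn0.
move=> k; rewrite ltnS leq_eqVlt => /predU1P[->//|].
apply: IHn => [j jn|j jn|]; [exact/fle/ltnW|exact/gle/ltnW|].
by move: eq_fg; rewrite eq_n => /addIn.
Qed.

Definition rev_table (d : nat) (p : 'S_d) (k : nat) : nat :=
  oapp (fun i : 'I_d => inv_table p (rev_ord i)) 0 (insub k).

Lemma rev_table_le (d : nat) (p : 'S_d) (k : nat) : k < d -> rev_table p k <= k.
Proof.
move=> kd; rewrite /rev_table insubT /=.
by apply: leq_trans (inv_table_le _ _) _ => /=; lia.
Qed.

Lemma aleph_nat_rev (d : nat) (p : 'S_d) :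
  aleph_nat p = \sum_(k < d) rev_table p k * k`!.
Proof.
rewrite /aleph_nat (reindex_inj rev_ord_inj) /=; apply: eq_bigr => k _.
rewrite /rev_table valK /=; congr (_ * _`!).
by have := ltn_ord k; lia.
Qed.

Lemma aleph_nat_lt (d : nat) (p : 'S_d) : aleph_nat p < d`!.
Proof. by rewrite aleph_nat_rev; apply: fact_base_lt => k; exact: rev_table_le. Qed.

Definition aleph (d : nat) (p : 'S_d) : 'I_(d`!) := Ordinal (aleph_nat_lt p).

Lemma inv_tableE (d : nat) (p : 'S_d) (i : 'I_d) :
  inv_table p i =
  #|[set v : 'I_d | (v < p i) && [forall j : 'I_d, (j < i) ==> (p j != v)]]|.
Proof.
rewrite /inv_table -(card_imset _ (@perm_inj _ p)).
apply: eq_card => v; rewrite !inE; apply/imsetP/andP.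
  case=> j; rewrite inE => /andP[ij pji] ->; split=> //.
  apply/forallP => k; apply/implyP => ki; rewrite (inj_eq perm_inj).
  by apply/eqP => kj; move: ki ij; rewrite kj; lia.
case=> vlt /forallP vnot; exists (p^-1 v)%g; last by rewrite permKV.
rewrite inE permKV vlt andbT.
have := vnot (p^-1 v)%g; rewrite permKV eqxx implybF -leqNgt leq_eqVlt.
case/predU1P => // /val_inj eqi; move: vlt.
by rewrite eqi permKV ltnn.
Qed.

Lemma inv_table_inj (d : nat) (p q : 'S_d) : inv_table p =1 inv_table q -> p = q.
Proof.
have key (r s : 'S_d) (i : 'I_d) : (forall j : 'I_d, j < i -> r j = s j) ->
    inv_table r i = inv_table s i -> s i <= r i.
  move=> IH eq_c; rewrite leqNgt; apply/negP => lt_rs.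
  suff : inv_table r i < inv_table s i by rewrite eq_c ltnn.
  rewrite !inv_tableE; apply/proper_card/properP; split.
    apply/subsetP => v; rewrite !inE => /andP[vr /forallP nv].
    rewrite (ltn_trans vr lt_rs) /=; apply/forallP => j; apply/implyP => ji.
    by rewrite -IH //; have := nv j; rewrite ji.
  exists (r i); rewrite !inE ?ltnn // lt_rs /=.
  apply/forallP => j; apply/implyP => ji; rewrite -IH // (inj_eq perm_inj).
  by apply/eqP => ej; rewrite ej ltnn in ji.
move=> eq_c.
have H n (i : 'I_d) : i < n -> p i = q i.
  elim: n i => // n IHn i; rewrite ltnS => le_in.
  have IH (j : 'I_d) : j < i -> p j = q j.
    by move=> ji; apply: IHn; exact: leq_trans ji le_in.
  apply/val_inj/eqP; rewrite eqn_leq (key p q) // andbT; apply: key => //.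
  by move=> j ji; rewrite IH.
by apply/permP => i; apply: (H d).
Qed.

Lemma aleph_inj (d : nat) : injective (@aleph d).
Proof.
move=> p q /(congr1 val) /=; rewrite !aleph_nat_rev => eq_pq.
apply: inv_table_inj => i.
have := fact_base_inj (@rev_table_le d p) (@rev_table_le d q) eq_pq
          (ltn_ord (rev_ord i)).
by rewrite /rev_table !valK /= rev_ordK.
Qed.

Lemma aleph_bij (d : nat) : bijective (@aleph d).
Proof. by apply: inj_card_bij (@aleph_inj d) _; rewrite card_Sn card_ord. Qed.

Lemma aleph_surj (d : nat) (N : 'I_(d`!)) : exists p : 'S_d, aleph p == N.
Proof. by have [g _ gK] := aleph_bij d; exists (g N); rewrite gK. Qed.

Definition aleph_inv (d : nat) (N : 'I_(d`!)) : 'S_d := xchoose (aleph_surj N).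

Lemma aleph_invK (d : nat) : cancel (@aleph_inv d) (@aleph d).
Proof. by move=> N; apply/eqP/(xchooseP (aleph_surj N)). Qed.

Lemma alephK (d : nat) : cancel (@aleph d) (@aleph_inv d).
Proof. by move=> p; apply: aleph_inj; rewrite aleph_invK. Qed.

(* Main.v *)
Require Import Defs.
From mathcomp Require Import all_boot all_order all_fingroup all_algebra.
From mathcomp Require Import zify.

(** Write [N = \sum_k e_k k!] with [e_k <= k].  Descents of the permutation are
    the descents of its inversion table, i.e. the [k] with [e_k < e_(k+1)].
    Put [q_m = N %/ m!]; since [e_(i+1) (i+1) + e_i = e_(i+1) (i+2) + (e_i - e_(i+1))],
    dividing [N] by [i! (i+2)] gives
    [(i+1) q_(i+2) + e_(i+1) - [e_i < e_(i+1)] = q_(i+1) - q_(i+2) - [e_i < e_(i+1)]].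
    Summing over [i] telescopes to [N = q_1 - q_d] minus the number of descents. *)

(** The sets counted by the two entries are nested. At a descent the set of [i] contains that of [j]
    and also [j] itself, so the inclusion is strict; otherwise the set of [i] lies inside that of
    [j]. *)
Lemma inv_table_descent (d : nat) (p : 'S_d) (i j : 'I_d) :
  j = i.+1 :> nat -> (p j < p i) = (inv_table p j < inv_table p i).
Proof.
move=> ji; have [pji|pij] := ltnP (p j) (p i).
  apply/esym/proper_card/properP; split; last by exists j; rewrite !inE ji ?ltnn ?ltnSn.
  by apply/subsetP => k; rewrite !inE; lia.
apply/esym/negbTE; rewrite -leqNgt; apply/subset_leq_card/subsetP => k.
rewrite !inE => /andP[ik pki]; rewrite (leq_trans pki pij) andbT.
rewrite ltn_neqAle ji ik andbT; apply/eqP => eq_k.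
have kj : k = j by apply: val_inj; rewrite /= -eq_k ji.
by move: pki; rewrite kj ltnNge pij.
Qed.

Lemma inv_table_rev (d : nat) (p : 'S_d) (i : 'I_d) :
  inv_table p i = rev_table p (d - i.+1).
Proof.
by rewrite /rev_table -[d - i.+1]/(val (rev_ord i)) valK /= rev_ordK.
Qed.

Lemma des_rev_table (n : nat) (p : 'S_n.+1) :
  des p = \sum_(k < n) (rev_table p k < rev_table p k.+1).
Proof.
rewrite /des -sum1dep_card big_mkcond big_ord_recr /=.
(* The last position has no successor, so its term is 0. *)
rewrite [X in _ + X]ifF ?addn0; last first.
  by apply/existsP => -[j /andP[/eqP jn _]]; have := ltn_ord j; rewrite jn ltnn.
rewrite (reindex_inj rev_ord_inj) /=; apply: eq_bigr => k _.
set i := widen_ord _ _; set j := lift ord0 (rev_ord k).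
have ji : j = i.+1 :> nat by rewrite lift0.
have -> : [exists j : 'I_n.+1, (j == i.+1 :> nat) && (p j < p i)] = (p j < p i).
  apply/existsP/idP => [[j' /andP[/eqP j'i]]|pji]; last by exists j; rewrite ji eqxx.
  by have -> : j' = j by apply: val_inj; rewrite /= j'i -ji.
rewrite (inv_table_descent _ _ _ _ ji) !inv_table_rev.
have kn := ltn_ord k.
have -> : n.+1 - j.+1 = k by rewrite ji /=; lia.
have -> : n.+1 - i.+1 = k.+1 by rewrite /=; lia.
by case: ifP.
Qed.

Lemma fact_base_digit (f : nat -> nat) (n m : nat) :
  (forall k, k < n -> f k <= k) -> m < n ->
  (\sum_(k < n) f k * k`!) %/ m`! %% m.+1 = f m.
Proof.
elim: n => // n IHn fle; rewrite big_ord_recr /= ltnS leq_eqVlt addnC.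
have fle' k : k < n -> f k <= k by move=> kn; apply/fle/ltnW.
case/predU1P => [->|mn].
  rewrite divnMDl ?fact_gt0 // divn_small ?fact_base_lt // addn0.
  by rewrite modn_small // ltnS fle.
(* For [m < n] the top term is a multiple of [(m+1)!], so after division by [m!] it vanishes modulo
   [m+1]. *)
have /dvdnP[t ->] : m.+1`! %| n`!.
  by rewrite -(ffact_fact (leq_subr m.+1 n)) subKn // dvdn_mull.
rewrite factS !mulnA divnMDl ?fact_gt0 // modnMDl.
exact: IHn.
Qed.

Lemma divn_fact_step (N i : nat) :
  N %/ (i`! * (i + 2)) + (N %/ i`! %% i.+1 < N %/ i.+1`! %% i.+2) + N %/ i.+2`!
  = N %/ i.+1`!.
Proof.
rewrite !factS [i.+2 * _]mulnC [i.+1 * _]mulnC !divnMA.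
set x := N %/ i`!; set y := x %/ i.+1.
have ex := divn_eq x i.+1; have := ltn_pmod x (ltn0Sn i).
rewrite -/y in ex; set b := x %% _ in ex *.
have ey := divn_eq y i.+2; have := ltn_pmod y (ltn0Sn i.+1).
set a := y %% _ in ey *; set q := y %/ _ in ey *.
move=> lta ltb; rewrite addn2.
(* As [b <= i] and [a <= i+1], the difference [b - a] becomes a remainder modulo [i+2] after
   borrowing one [i+2] exactly when [b < a]. *)
have -> : x = (q * i.+1 + (a - (b < a))) * i.+2 + (b + (b < a) * i.+2 - a).
  by case: ltnP; nia.
rewrite divnMDl // divn_small; last by case: ltnP; nia.
by case: ltnP; nia.
Qed.

Theorem theorem6p4 (d N : nat) (hd : (2 <= d)%N) (hN : (N < d`!)%N) :
  ((des (aleph_inv (Ordinal hN)))%:Z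
   = N%:Z - \sum_(0 <= i < d.-1) (N %/ (i`! * (i + 2)))%N%:Z)%R.
Proof.
have eN : aleph_nat (aleph_inv (Ordinal hN)) = N.
  by have /(congr1 val) := aleph_invK (Ordinal hN).
move: (aleph_inv _) eN => p eN.
case: d hd hN p eN => // n _ hN p eN.
have digit k : k < n.+1 -> rev_table p k = N %/ k`! %% k.+1.
  move=> kn; rewrite -eN aleph_nat_rev fact_base_digit // => j.
  exact: rev_table_le.
(* Keeping the tail [N %/ (m+1)!] as a summand avoids truncated subtraction. *)
have telescope m : m <= n ->
    \sum_(i < m) N %/ (i`! * (i + 2))
    + \sum_(k < m) (rev_table p k < rev_table p k.+1) + N %/ m.+1`! = N.
  elim: m => [|m IHm] mn; first by rewrite !big_ord0 divn1.
  rewrite !big_ord_recr /= !digit ?ltnS ?(ltnW mn) // addnACA -addnA divn_fact_step.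
  exact: IHm (ltnW mn).
(* At [m = n] the tail is [N %/ d!], which is 0 because [N < d!]. *)
have := telescope n (leqnn n); rewrite divn_small // addn0 -des_rev_table => eq_N.
rewrite big_mkord -(big_morph Posz PoszD (erefl _)) /=.
by rewrite -[X in (X%:Z - _)%R]eq_N PoszD GRing.addrC GRing.addKr.
Qed.
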